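(* Let $F \subseteq E$ be a Galois extension and let $\mathfrak{g}$ and $\mathfrak{h}$ be finite-dimensional Lie algebras over $E$ such that $\mathfrak{g}_F \cong \mathfrak{h}_F$ as Lie algebras over $F$. If $\mathfrak{g} \cong \bigoplus_{i=1}^k \mathfrak{g}_i$ is a decomposition of $\mathfrak{g}$ into indecomposable ideals, then there exist $\sigma_1, \ldots, \sigma_k \in \mathrm{Gal}(E,F)$ such that $$\mathfrak{h} \cong \bigoplus_{i=1}^k \mathfrak{g}_i^{\sigma_i}$$ as Lie algebras over $E$.
   Context: A Galois extension $F \subseteq E$ means a field extension of finite degree with $|\mathrm{Aut}(E,F)| = [E:F]$, where $\mathrm{Aut}(E,F)$ is the group of field automorphisms of $E$ fixing $F$ pointwise; then $\mathrm{Gal}(E,F) = \mathrm{Aut}(E,F)$. The underlying Lie algebra $\mathfrak{g}_F$ is $\mathfrak{g}$ regarded as a Lie algebra over $F$ by restricting the scalar multiplication. A Lie algebra is decomposable if it is the direct sum of two proper ideals, and indecomposable otherwise. For a field automorphism $\sigma$ of $E$, a map $\varphi: V \to W$ between $E$-vector spaces is $\sigma$-linear if $\varphi(\lambda v + \mu w) = \sigma(\lambda)\varphi(v) + \sigma(\mu)\varphi(w)$ for all $v,w \in V$, $\lambda,\mu \in E$; a $\sigma$-isomorphism of Lie algebras over $E$ is a bijective $\sigma$-linear map preserving the Lie bracket. The $\sigma$-conjugate $\mathfrak{g}^\sigma$ of a Lie algebra $\mathfrak{g}$ over $E$ is the Lie algebra over $E$, unique up to isomorphism, for which there exists a $\sigma$-isomorphism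 $\mathfrak{g} \to \mathfrak{g}^\sigma$. *)

(* Defs.v *)
From HB Require Import structures.
From mathcomp Require Import all_boot all_order all_fingroup all_algebra all_field.

Set Implicit Arguments.
Unset Strict Implicit.
Unset Printing Implicit Defensive.

Import GRing.Theory.
Local Open Scope ring_scope.

HB.mixin Record Lmodule_isLieAlgebra (K : fieldType) L
    of GRing.Lmodule K L := {
  lie_br : L -> L -> L;
  lie_brPl : forall a x y z,
    lie_br (a *: x + y) z = a *: lie_br x z + lie_br y z;
  lie_brPr : forall a x y z,
    lie_br x (a *: y + z) = a *: lie_br x y + lie_br x z;
  lie_brxx : forall x, lie_br x x = 0;
  lie_jacobi : forall x y z,
    lie_br x (lie_br y z) + lie_br y (lie_br z x) + lie_br z (lie_br x y) = 0
}.

#[short(type="lieAlgType")]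
HB.structure Definition LieAlgebra (K : fieldType) :=
  { L of GRing.Lmodule K L & Lmodule_isLieAlgebra K L }.

#[short(type="finLieAlgType")]
HB.structure Definition FinLieAlgebra (K : fieldType) :=
  { L of LieAlgebra K L & Vector K L }.

Definition lie_isomorphic (K : fieldType) (L M : lieAlgType K) : Prop :=
  exists f : {linear L -> M},
    bijective f /\ {morph f : x y / lie_br x y >-> lie_br x y}.

(* One-sided absorption is enough, since the bracket is antisymmetric. *)
Definition lie_ideal (K : fieldType) (L : finLieAlgType K) (I : {vspace L}) :
    Prop :=
  forall x y : L, y \in I -> lie_br x y \in I.

Definition decomposable (K : fieldType) (L : finLieAlgType K) : Prop :=
  exists I J : {vspace L},
    [/\ lie_ideal I /\ lie_ideal J, I != fullv, J != fullv,
        (I + J)%VS = fullv & (I :&: J)%VS = 0%VS].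

(* The zero algebra has no proper ideal, hence it is indecomposable. *)
Definition indecomposable (K : fieldType) (L : finLieAlgType K) : Prop :=
  ~ decomposable L.

Section DirectSum.
Variables (K : fieldType) (I : finType) (L : I -> lieAlgType K).

Definition lie_dsum : Type := {dffun forall i, L i}.

HB.instance Definition _ := Choice.on lie_dsum.

Definition dsum_mk (f : forall i, L i) : lie_dsum := [ffun i => f i].
Definition dsum_proj (u : lie_dsum) : forall i, L i := fun i => u i.

Lemma dsum_mkE f i : dsum_proj (dsum_mk f) i = f i.
Proof. by rewrite /dsum_proj ffunE. Qed.

Lemma dsumP (u v : lie_dsum) :
  (forall i, dsum_proj u i = dsum_proj v i) -> u = v.
Proof. by move=> uv; apply/ffunP => i; exact: uv. Qed.

Definition dsum_zero := dsum_mk (fun=> 0).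
Definition dsum_opp u := dsum_mk (fun i => - dsum_proj u i).
Definition dsum_add u v := dsum_mk (fun i => dsum_proj u i + dsum_proj v i).
Definition dsum_scale (a : K) u := dsum_mk (fun i => a *: dsum_proj u i).
Definition dsum_br u v :=
  dsum_mk (fun i => lie_br (dsum_proj u i) (dsum_proj v i)).

Fact dsum_addA : associative dsum_add.
Proof. by move=> u v w; apply: dsumP => i; rewrite !dsum_mkE addrA. Qed.
Fact dsum_addC : commutative dsum_add.
Proof. by move=> u v; apply: dsumP => i; rewrite !dsum_mkE addrC. Qed.
Fact dsum_add0 : left_id dsum_zero dsum_add.
Proof. by move=> u; apply: dsumP => i; rewrite !dsum_mkE add0r. Qed.
Fact dsum_addN : left_inverse dsum_zero dsum_opp dsum_add.
Proof. by move=> u; apply: dsumP => i; rewrite !dsum_mkE addNr. Qed.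

HB.instance Definition _ := GRing.isZmodule.Build lie_dsum
  dsum_addA dsum_addC dsum_add0 dsum_addN.

Fact dsum_scaleA a b u :
  dsum_scale a (dsum_scale b u) = dsum_scale (a * b) u.
Proof. by apply: dsumP => i; rewrite !dsum_mkE scalerA. Qed.
Fact dsum_scale1 : left_id 1 dsum_scale.
Proof. by move=> u; apply: dsumP => i; rewrite !dsum_mkE scale1r. Qed.
Fact dsum_scaleDr : right_distributive dsum_scale +%R.
Proof. by move=> a u v; apply: dsumP => i; rewrite !dsum_mkE scalerDr. Qed.
Fact dsum_scaleDl u : {morph dsum_scale^~ u : a b / a + b}.
Proof. by move=> a b; apply: dsumP => i; rewrite !dsum_mkE scalerDl. Qed.

HB.instance Definition _ := GRing.Zmodule_isLmodule.Build K lie_dsum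
  dsum_scaleA dsum_scale1 dsum_scaleDr dsum_scaleDl.

Fact dsum_brPl (a : K) (x y z : lie_dsum) :
  dsum_br (a *: x + y) z = a *: dsum_br x z + dsum_br y z.
Proof. by apply: dsumP => i; rewrite !dsum_mkE lie_brPl. Qed.
Fact dsum_brPr (a : K) (x y z : lie_dsum) :
  dsum_br x (a *: y + z) = a *: dsum_br x y + dsum_br x z.
Proof. by apply: dsumP => i; rewrite !dsum_mkE lie_brPr. Qed.
Fact dsum_brxx (x : lie_dsum) : dsum_br x x = 0.
Proof. by apply: dsumP => i; rewrite !dsum_mkE lie_brxx. Qed.
Fact dsum_jacobi (x y z : lie_dsum) :
  dsum_br x (dsum_br y z) + dsum_br y (dsum_br z x) + dsum_br z (dsum_br x y)
  = 0.
Proof. by apply: dsumP => i; rewrite !dsum_mkE lie_jacobi. Qed.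

HB.instance Definition _ := Lmodule_isLieAlgebra.Build K lie_dsum
  dsum_brPl dsum_brPr dsum_brxx dsum_jacobi.

End DirectSum.

(* L with scalars acting through phi, i.e. a *: x := phi a *: x; the addition *)
(* and the bracket are those of L.                                            *)
Definition lie_pullback (K K' : fieldType) (phi : {rmorphism K -> K'})
  (L : lieAlgType K') : Type := L.

Section Pullback.
Variables (K K' : fieldType) (phi : {rmorphism K -> K'}) (L : lieAlgType K').

Local Notation P := (lie_pullback phi L).

HB.instance Definition _ := GRing.Zmodule.copy P L.

Definition pullback_scale (a : K) (x : P) : P := phi a *: (x : L).

Fact pullback_scaleA a b x :
  pullback_scale a (pullback_scale b x) = pullback_scale (a * b) x.
Proof. by rewrite /pullback_scale scalerA rmorphM. Qed.
Fact pullback_scale1 : left_id 1 pullback_scale.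
Proof. by move=> x; rewrite /pullback_scale rmorph1 scale1r. Qed.
Fact pullback_scaleDr : right_distributive pullback_scale +%R.
Proof. by move=> a x y; apply: scalerDr. Qed.
Fact pullback_scaleDl x : {morph pullback_scale^~ x : a b / a + b}.
Proof. by move=> a b; rewrite /pullback_scale rmorphD scalerDl. Qed.

HB.instance Definition _ := GRing.Zmodule_isLmodule.Build K P
  pullback_scaleA pullback_scale1 pullback_scaleDr pullback_scaleDl.

Definition pullback_br (x y : P) : P := lie_br (x : L) (y : L).

Fact pullback_brPl (a : K) (x y z : P) :
  pullback_br (a *: x + y) z = a *: pullback_br x z + pullback_br y z.
Proof. exact: (lie_brPl (phi a) (x : L)). Qed.
Fact pullback_brPr (a : K) (x y z : P) :
  pullback_br x (a *: y + z) = a *: pullback_br x y + pullback_br x z.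
Proof. exact: (lie_brPr (phi a) (x : L)). Qed.
Fact pullback_brxx (x : P) : pullback_br x x = 0.
Proof. exact: (lie_brxx (x : L)). Qed.
Fact pullback_jacobi (x y z : P) :
  pullback_br x (pullback_br y z) + pullback_br y (pullback_br z x)
    + pullback_br z (pullback_br x y) = 0.
Proof. exact: (lie_jacobi (x : L)). Qed.

HB.instance Definition _ := Lmodule_isLieAlgebra.Build K P
  pullback_brPl pullback_brPr pullback_brxx pullback_jacobi.

End Pullback.

Definition underlying_lie (F : fieldType) (E : splittingFieldType F)
    (L : lieAlgType E) : lieAlgType F :=
  lie_pullback (GRing.in_alg E) L.

(* A scalar a acts on the sigma-conjugate as sigma^-1 a, so that the identity *)
(* map L -> lie_conjugate sigma L is sigma-linear: see lie_conjugateP and     *)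
(* lie_conjugate_uniq below.                                                  *)
Definition lie_conjugate (F : fieldType) (E : splittingFieldType F)
    (sigma : gal_of {:E}) (L : lieAlgType E) : lieAlgType E :=
  lie_pullback (fun_of_lfun (sigma^-1)%g : {rmorphism E -> E}) L.

Definition sigma_isomorphic (K : fieldType) (sigma : K -> K)
    (L M : lieAlgType K) : Prop :=
  exists f : L -> M,
    [/\ forall a b v w, f (a *: v + b *: w) = sigma a *: f v + sigma b *: f w,
        bijective f & {morph f : x y / lie_br x y >-> lie_br x y}].

Section Conjugate.
Variables (F : fieldType) (E : splittingFieldType F) (sigma : gal_of {:E}).

Lemma galK (a : E) : (sigma^-1)%g (sigma a) = a.
Proof. by rewrite -galM ?memvf // mulgV gal_id. Qed.

Lemma lie_conjugateP (L : lieAlgType E) :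
  sigma_isomorphic sigma L (lie_conjugate sigma L).
Proof.
exists (fun x : L => x : lie_conjugate sigma L); split=> // [a b v w|].
  by rewrite -[in LHS](galK a) -[in LHS](galK b).
by exists id.
Qed.

Lemma lie_conjugate_uniq (L M : lieAlgType E) :
  sigma_isomorphic sigma L M -> lie_isomorphic (lie_conjugate sigma L) M.
Proof.
case=> f [fL bij_f fM].
pose g : lie_conjugate sigma L -> M := f.
have g_lin : linear g.
  move=> a x y; rewrite /g.
  have := fL ((sigma^-1)%g a) 1 x y.
  by rewrite rmorph1 !scale1r -galM ?memvf // mulVg gal_id.
pose gM := GRing.isLinear.Build _ _ _ _ g g_lin.
pose gl : {linear _ -> _} := HB.pack g gM.
by exists gl.
Qed.

End Conjugate.

(* For a splitting field E of F, the library's Galois condition amounts to    *)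
(* |Aut(E, F)| = [E : F].                                                     *)
Lemma galois_cardE (F : fieldType) (E : splittingFieldType F) :
  galois 1 {:E} = (#|'Gal({:E} / 1)%g| == \dim {:E}).
Proof.
apply/idP/eqP => [/galois_dim <-|cardG]; first by rewrite dimv1 divn1.
apply/galois_fixedField/eqP; rewrite eq_sym eqEdim sub1v dimv1 /=.
set K := fixedField _; have sKE : (K <= {:E})%VS by apply: subvf.
have := dim_sup_field sKE; rewrite -dim_fixedField /= cardG.
by rewrite -[LHS]muln1 => /eqP; rewrite eqn_pmul2l ?adim_gt0 // => /eqP <-.
Qed.

(* Main.v *)
(* Choose dual bases e, f of E over F for the trace form. Every F-linear map
   u between E-vector spaces is then the sum over s in Gal(E/F) of the
   s-linear maps u_s(x) = sum_l s(e_l) u(f_l x). Let iota be the restriction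
   of g_F = h_F to an indecomposable summand V of g, and kappa its
   equivariant retraction. On [V, V] the maps kappa iota_s are E-linear
   idempotents, and they come from the E-centroid of V; by indecomposability
   each is 0 or 1 there, so iota is s-linear on [V, V] for some s. Gluing
   the corresponding iota_s gives an E-linear Lie map G from the sum of the
   conjugates to h, which differs from the given isomorphism by a central
   map vanishing on the derived algebra. A nonabelian indecomposable algebra
   has its center inside its derived algebra, so G is injective on the
   nonabelian summands; their image and the center of h span h, and the
   abelian summands can be sent onto a central complement of that image. *)

Require Import Defs.
From HB Require Import structures.
From mathcomp Require Import all_boot all_order all_fingroup all_algebra all_field.

Set Implicit Arguments.
Unset Strict Implicit.
Unset Printing Implicit Defensive.

Import GRing.Theory.
Local Open Scope ring_scope.

(** * Dual bases for the trace form *)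

Section TraceForm.
Variables (F : fieldType) (E : splittingFieldType F).
Hypothesis galE : galois 1 {:E}.

Local Notation Tr := (galTrace 1 {:E}).
Local Notation n := (\dim {:E}).

Lemma galTrace_scale (k : F) (a : E) : Tr (k *: a) = k *: Tr a.
Proof.
by rewrite /galTrace scaler_sumr; apply: eq_bigr => x _; rewrite linearZ.
Qed.

(** For a Galois extension the trace takes values in the line spanned by [1]; its coordinate there
    is the trace with values in [F]. *)
Definition trF (a : E) : F := coord [tuple (1 : E)] ord0 (Tr a).

Lemma trF_linear : scalar trF.
Proof.
by move=> k a b; rewrite /trF raddfD /= galTrace_scale linearP.
Qed.
HB.instance Definition _ := GRing.isLinear.Build F E F _ trF trF_linear.

Lemma trFE a : Tr a = (trF a)%:A.
Proof.
have Tra : Tr a \in <<[tuple (1%R : E)]>>%VS.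
  by rewrite span_seq1; apply: (mem_galTrace galE (memvf a)).
by rewrite (coord_span Tra) big_ord1.
Qed.

(** Otherwise, as [a] is invertible, the trace would vanish on all of [E], against Dedekind's
    independence of automorphisms. *)
Lemma trF_nondegenerate a : (forall b, trF (a * b) = 0) -> a = 0.
Proof.
move=> tr0; apply/eqP/idPn => nz_a.
have Tr0 b : b \in {:E}%VS ->
    \sum_(x in 'Gal({:E} / 1)%g) (fun=> 1 : E) x * x b = 0.
  move=> _; under eq_bigr do rewrite mul1r.
  by rewrite -[LHS]/(Tr b) -(mulVKf nz_a b) trFE tr0 scale0r.
by have /eqP := gal_independent Tr0 (group1 _); rewrite oner_eq0.
Qed.

(** The first two clauses say that the tensor sum of the [e l] and [f l] is the separability
    idempotent of [E] over [F]: multiplication by [a] on either factor gives the same tensor, and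
    the product is 1. The third expands 1 in the basis [f]. *)
Lemma trace_dual_bases : exists e f : 'I_n -> E,
  [/\ forall a, exists c : 'I_n -> 'I_n -> F,
        (forall l, f l * a = \sum_m c l m *: f m) /\
        (forall m, a * e m = \sum_l c l m *: e l),
      \sum_l e l * f l = 1 & \sum_l Tr (e l) * f l = 1].
Proof.
pose f (l : 'I_n) : E := (vbasis {:E})`_l.
pose Th a : 'rV[F]_n := \row_l trF (a * f l).
have Th_lin : linear Th.
  by move=> k a b; apply/rowP => l; rewrite !mxE mulrDl -scalerAl linearP.
pose ThM := GRing.isLinear.Build _ _ _ _ Th Th_lin.
pose ThL : {linear E -> 'rV[F]_n} := HB.pack Th ThM.
have fE a : a = \sum_l coord (vbasis {:E}) l a *: f l.
  by apply: coord_vbasis; apply: memvf.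
have ker0 : lker (linfun ThL) == 0%VS.
  rewrite -subv0; apply/subvP => a; rewrite memv_ker lfunE /= memv0 => /eqP Tha.
  apply/eqP/trF_nondegenerate => b.
  rewrite [b]fE mulr_sumr linear_sum big1 // => l _.
  have /rowP/(_ l) := Tha; rewrite !mxE -scalerAr linearZ /= => ->.
  by rewrite mulr0.
have full : limg (linfun ThL) = fullv.
  apply/eqP; rewrite eqEdim subvf limg_dim_eq ?(eqP ker0) ?capv0 //.
  by rewrite dimvf /dim /= mul1n.
(* Nondegeneracy makes [Th] bijective; the preimages of the unit vectors form the basis dual to
   [f]. *)
pose e (l : 'I_n) : E := ((linfun ThL)^-1)%VF (delta_mx 0 l).
have ef (l m : 'I_n) : trF (e l * f m) = (l == m)%:R.
  have /rowP/(_ m) : Th (e l) = delta_mx 0 l.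
    by rewrite -[Th _](lfunE ThL) limg_lfunVK ?full ?memvf.
  by rewrite !mxE eqxx eq_sym.
have feE a : a = \sum_l trF (e l * a) *: f l.
  rewrite [LHS]fE; apply: eq_bigr => l _; congr (_ *: _).
  rewrite [in RHS](fE a) mulr_sumr linear_sum (bigD1 l) //= big1 => [|m ml].
    by rewrite -scalerAr linearZ /= ef eqxx mulr1 addr0.
  by rewrite -scalerAr linearZ /= ef eq_sym (negPf ml) mulr0.
have efE a : a = \sum_l trF (a * f l) *: e l.
  apply/eqP; rewrite -subr_eq0; apply/eqP/trF_nondegenerate => b.
  rewrite [b]feE mulr_sumr linear_sum big1 // => l _.
  rewrite -scalerAr linearZ /= mulrBl linearB /= mulr_suml linear_sum.
  rewrite (bigD1 l) //= big1 => [|m ml].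
    by rewrite -scalerAl linearZ /= ef eqxx mulr1 addr0 subrr mulr0.
  by rewrite -scalerAl linearZ /= ef (negPf ml) mulr0.
exists e, f; split.
- move=> a; exists (fun l m => trF (e m * (f l * a))); split=> [l|m].
    exact: feE.
  rewrite [LHS]efE; apply: eq_bigr => l _; congr (trF _ *: _).
  by rewrite [RHS]mulrA [RHS]mulrC mulrA.
(* Expanding [a] in [f] gives [\sum_x (\sum_l x (e l) * f l) * x a = a]; by independence of
   automorphisms the coefficient of the identity is 1. *)
- pose c (x : gal_of {:E}) := \sum_l x (e l) * f l - (x == 1%g)%:R.
  have c0 a : a \in {:E}%VS -> \sum_(x in 'Gal({:E} / 1)%g) c x * x a = 0.
    move=> _; rewrite /c; under eq_bigr do rewrite mulrBl.
    rewrite sumrB [X in _ - X](bigD1 1%g) ?group1 //= eqxx mul1r gal_id.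
    rewrite [X in _ - (_ + X)]big1 => [|x /andP[_ /negPf->]]; last first.
      by rewrite mul0r.
    rewrite addr0; apply/eqP; rewrite subr_eq0; apply/eqP.
    under eq_bigr do rewrite mulr_suml.
    rewrite exchange_big [RHS]feE; apply: eq_bigr => l _ /=.
    rewrite -[RHS]mulr_algl -trFE /galTrace mulr_suml.
    by apply: eq_bigr => x _; rewrite rmorphM mulrAC.
  have /eqP := gal_independent c0 (group1 _).
  rewrite /c eqxx subr_eq0 => /eqP c1; rewrite -[RHS]c1.
  by apply: eq_bigr => l _; rewrite gal_id.
rewrite [RHS]feE; apply: eq_bigr => l _.
by rewrite mulr1 trFE mulr_algl.
Qed.

End TraceForm.

(** * Centers and derived algebras *)

Section Bracket.
Variables (K : fieldType) (L : lieAlgType K).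
Implicit Types (a : K) (x y z : L).

HB.instance Definition _ x :=
  GRing.isLinear.Build K L L _ (lie_br x) (fun a y z => lie_brPr a x y z).

Definition lie_brr y x := lie_br x y.

HB.instance Definition _ y :=
  GRing.isLinear.Build K L L _ (lie_brr y) (fun a x z => lie_brPl a x z y).

Lemma lie_br0r x : lie_br x 0 = 0. Proof. exact: linear0. Qed.
Lemma lie_br0l y : lie_br 0 y = 0. Proof. exact: (linear0 (lie_brr y)). Qed.
Lemma lie_brDl x z y : lie_br (x + z) y = lie_br x y + lie_br z y.
Proof. exact: (linearD (lie_brr y)). Qed.
Lemma lie_brBl x z y : lie_br (x - z) y = lie_br x y - lie_br z y.
Proof. exact: (linearB (lie_brr y)). Qed.
Lemma lie_brZl a x y : lie_br (a *: x) y = a *: lie_br x y.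
Proof. exact: (linearZ_LR (lie_brr y)). Qed.
Lemma lie_br_suml I r (P : pred I) (x : I -> L) y :
  lie_br (\sum_(i <- r | P i) x i) y = \sum_(i <- r | P i) lie_br (x i) y.
Proof. exact: (linear_sum (lie_brr y)). Qed.
Lemma lie_brC x y : lie_br x y = - lie_br y x.
Proof.
have := lie_brxx (x + y); rewrite linearD /= !lie_brDl !lie_brxx add0r addr0.
by rewrite addrC => /eqP; rewrite addr_eq0 => /eqP.
Qed.

End Bracket.

Section Derived.
Variables (K : fieldType) (L : finLieAlgType K).
Implicit Types (x y z : L).

Definition derived : {vspace L} :=
  (\sum_(i < \dim {:L}) limg (linfun (lie_br (vbasis {:L})`_i)))%VS.

Lemma br_derived x y : lie_br x y \in derived.
Proof.
rewrite [x](coord_vbasis (memvf x)) lie_br_suml memv_suml // => i _.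
rewrite lie_brZl memvZ //; apply: (subvP (sumv_sup i isT (subvv _))).
by rewrite -[lie_br _ y]lfunE memv_img ?memvf.
Qed.

(** Scalars are absorbed into the bracket, so every element of the derived algebra is a plain sum of
    brackets. *)
Lemma derived_ind (P : L -> Prop) :
    (forall x y, P x -> P y -> P (x + y)) -> (forall x y, P (lie_br x y)) ->
  forall x, x \in derived -> P x.
Proof.
move=> PD Pbr x /memv_sumP[u du ->]; apply: big_ind => // [|i _].
  by rewrite -(lie_br0l 0).
by have /memv_imgP[y _ ->] := du i isT; rewrite lfunE; apply: Pbr.
Qed.

Definition central x := forall y, lie_br x y = 0.

Definition center : {vspace L} :=
  (\bigcap_(i < \dim {:L}) lker (linfun (lie_brr (vbasis {:L})`_i)))%VS.

Lemma centerP x : reflect (central x) (x \in center).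
Proof.
rewrite memvE; apply: (iffP subv_bigcapP) => [zx y | zx i _]; last first.
  by rewrite -memvE memv_ker lfunE; apply/eqP/zx.
rewrite [y](coord_vbasis (memvf y)) linear_sum big1 // => i _.
have xb : lie_br x (vbasis {:L})`_i = 0.
  by apply/eqP; have := zx i isT; rewrite -memvE memv_ker lfunE.
by rewrite linearZ /= xb scaler0.
Qed.

Lemma ideal_of_derived (U : {vspace L}) : (derived <= U)%VS -> lie_ideal U.
Proof. by move=> /subvP dU x y _; apply/dU/br_derived. Qed.

Lemma ideal_of_center (U : {vspace L}) : (U <= center)%VS -> lie_ideal U.
Proof.
move=> /subvP Uz x y /Uz/centerP zy.
by rewrite lie_brC zy oppr0 mem0v.
Qed.

Hypothesis indecL : indecomposable L.

Lemma indecomposable_split (U V : {vspace L}) :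
    lie_ideal U -> lie_ideal V -> (U + V)%VS = fullv -> (U :&: V)%VS = 0%VS ->
  U = fullv \/ V = fullv.
Proof.
move=> iU iV UV1 UV0.
have [|nU] := eqVneq U fullv; first by left.
have [|nV] := eqVneq V fullv; first by right.
by case: indecL; exists U, V.
Qed.

(* A central vector outside [L, L] spans a direct factor. *)
Lemma center_sub_derived : derived != 0%VS -> (center <= derived)%VS.
Proof.
move=> d0; apply/subvP => z Zz; apply/idPn => ndz.
(* [H] is a complement of the line [U] that contains [[L, L]], so both are ideals. [U] being
   everything would make [L] abelian, and [H] being everything would give [z = 0]. *)
pose U := (<[z]>)%VS; pose H := (derived + (derived + U)^C)%VS.
have Uz : (U <= center)%VS by rewrite -memvE.
have UH1 : (U + H)%VS = fullv.
  by rewrite /H addvA [(U + _)%VS]addvC addv_complf.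
have UH0 : (U :&: H)%VS = 0%VS.
  apply/eqP; rewrite -subv0; apply/subvP => _ /memv_capP[/vlineP[a ->]].
  case/memv_addP=> y dy [w Cw e].
  have : w \in ((derived + U) :&: (derived + U)^C)%VS.
    rewrite memv_cap Cw andbT -[w](addKr y) -e.
    by rewrite memv_add ?rpredN ?rpredZ ?memv_line.
  rewrite capv_compl memv0 => /eqP w0; move: e; rewrite w0 addr0 => e.
  have [-> |na] := eqVneq a 0; first by rewrite scale0r mem0v.
  by case/negP: ndz; move: dy; rewrite -e rpredZeq (negPf na).
have [] := indecomposable_split (ideal_of_center Uz)
  (ideal_of_derived (addvSl _ _)) UH1 UH0.
  move=> U1; case/eqP: d0; apply/eqP; rewrite -subv0; apply/subvP => x.
  apply: (@derived_ind (fun u => u \in 0%VS)) => [u v|u v]; first exact: rpredD.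
  have /centerP-> : u \in center by apply: (subvP Uz); rewrite U1 memvf.
  by rewrite mem0v.
move=> H1; move: UH0; rewrite /H H1 capvf => U0.
case/negP: ndz; have := memv_line z; rewrite -/U U0 memv0 => /eqP->.
exact: mem0v.
Qed.

Variable q : 'End(L).
Hypothesis qC : forall x y, q (lie_br x y) = lie_br (q x) y.
Hypothesis qI : forall x, x \in derived -> q (q x) = q x.

(* q^2 - q kills [L, L] and has central values, so that q^4 = 2 q^3 - q^2 and *)
(* L is the direct sum of the image and the kernel of q^2.                    *)
Lemma centroid_idempotent :
  (forall x, x \in derived -> q x = 0) \/ (forall x, x \in derived -> q x = x).
Proof.
have [d0|d0] := eqVneq derived 0%VS.
  by left=> x; rewrite d0 memv0 => /eqP ->; rewrite linear0.
have zd := subvP (center_sub_derived d0).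
have q4 x : q (q (q (q x))) = q (q (q x)) *+ 2 - q (q x).
  (* Being central, this element lies in [[L, L]], where [q] is idempotent. *)
  have /zd/qI : q (q x) - q x \in center.
    by apply/centerP => y; rewrite lie_brBl -!qC qI ?br_derived // subrr.
  rewrite !linearB /= => /eqP.
  by rewrite subr_eq => /eqP->; rewrite addrAC mulr2n.
have q2C x y : (q \o q)%VF (lie_br x y) = lie_br ((q \o q)%VF x) y.
  by rewrite !comp_lfunE !qC.
have q2Cr x y : (q \o q)%VF (lie_br x y) = lie_br x ((q \o q)%VF y).
  by rewrite [lie_br x y]lie_brC linearN /= q2C -lie_brC.
have iK : lie_ideal (lker (q \o q)).
  by move=> x y; rewrite !memv_ker => /eqP qy; rewrite q2Cr qy lie_br0r.
have iI : lie_ideal (limg (q \o q)).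
  by move=> x _ /memv_imgP[y _ ->]; rewrite -q2Cr memv_img ?memvf.
have IK0 : (limg (q \o q) :&: lker (q \o q))%VS = 0%VS.
  apply/eqP; rewrite -subv0; apply/subvP => _ /memv_capP[/memv_imgP[y _ ->]].
  rewrite memv_ker memv0 !comp_lfunE => /eqP q4y.
  (* The relation at [q y] kills the third power, then at [y] the second; no division by 2
     occurs. *)
  have q3y : q (q (q y)) = 0.
    have := q4 (q y); rewrite q4y linear0 mul0rn sub0r => /esym/eqP.
    by rewrite oppr_eq0 => /eqP.
  by have := q4 y; rewrite q4y q3y mul0rn sub0r => /esym/eqP; rewrite oppr_eq0.
have IK1 : (limg (q \o q) + lker (q \o q))%VS = fullv.
  apply/eqP; rewrite eqEdim subvf dimv_disjoint_sum //.
  by rewrite addnC -(limg_ker_dim (q \o q) fullv) capfv leqnn.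
have [I1|K1] := indecomposable_split iI iK IK1 IK0; [right|left]=> x dx.
  have K0 : lker (q \o q) == 0%VS by rewrite -IK0 I1 capfv.
  by apply: (lker0P K0); rewrite !comp_lfunE !(qI dx).
have : x \in lker (q \o q) by rewrite K1 memvf.
by rewrite memv_ker comp_lfunE (qI dx) => /eqP.
Qed.

End Derived.

(** * Semilinear components of F-linear maps *)

Section FLinear.
Variables (F : fieldType) (E : splittingFieldType F).

(** Stated between E-modules, with [F] acting through [k%:A], so that scalars of [E] remain at
    hand. *)
Definition F_linear (V W : lmodType E) (u : V -> W) :=
  forall (k : F) x y, u (k%:A *: x + y) = k%:A *: u x + u y.

Section Basics.
Variables (V W : lmodType E) (u : V -> W).
Hypothesis uF : F_linear u.

Lemma F_linear_zmod : zmod_morphism u.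
Proof.
move=> x y; have := uF (-1) y x.
by rewrite !(scaleNr, scale1r) ![- _ + _]addrC.
Qed.

HB.instance Definition _ := GRing.isZmodMorphism.Build V W u F_linear_zmod.

Lemma F_linear0 : u 0 = 0. Proof. exact: raddf0. Qed.
Lemma F_linearD x y : u (x + y) = u x + u y. Proof. exact: raddfD. Qed.
Lemma F_linearN x : u (- x) = - u x. Proof. exact: raddfN. Qed.
Lemma F_linear_sum I r (P : pred I) (x : I -> V) :
  u (\sum_(i <- r | P i) x i) = \sum_(i <- r | P i) u (x i).
Proof. exact: raddf_sum. Qed.
Lemma F_linearZ (k : F) x : u (k%:A *: x) = k%:A *: u x.
Proof. by have := uF k x 0; rewrite F_linear0 !addr0. Qed.

End Basics.

Lemma F_linear_comp (V W X : lmodType E) (u : W -> X) (v : V -> W) :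
  F_linear u -> F_linear v -> F_linear (u \o v).
Proof. by move=> uF vF k x y; rewrite /= vF uF. Qed.

Lemma F_linear_linear (V W : lmodType E) (u : {linear V -> W}) : F_linear u.
Proof. by move=> k x y; rewrite linearP. Qed.

End FLinear.

(* e and f are meant to be dual bases of E over F for the trace form. For     *)
(* every F-linear u, [twist s u] is its s-linear component: u is the sum of   *)
(* these components over the Galois group.                                    *)
Section Twist.
Variables (F : fieldType) (E : splittingFieldType F) (n : nat).
Variables e f : 'I_n -> E.
Hypothesis ef_balanced : forall a, exists c : 'I_n -> 'I_n -> F,
  (forall l, f l * a = \sum_m c l m *: f m) /\
  (forall m, a * e m = \sum_l c l m *: e l).
Hypothesis ef1 : \sum_l e l * f l = 1.
Hypothesis ef_trace : \sum_l galTrace 1 {:E} (e l) * f l = 1.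
Implicit Types (s : gal_of {:E}) (a : E).

Definition twist (V W : lmodType E) s (u : V -> W) (x : V) : W :=
  \sum_l s (e l) *: u (f l *: x).

Section TwistTheory.
Variables (V W : lmodType E) (s : gal_of {:E}) (u : V -> W).
Hypothesis uF : F_linear u.

(** The balance of the dual bases moves [a] from the [f l] to the [e l]; the matrix entries lie in
    [F] and pass through [u]. *)
Lemma twistZ a x : twist s u (a *: x) = s a *: twist s u x.
Proof.
have [c [fc ec]] := ef_balanced a.
rewrite /twist scaler_sumr.
under eq_bigr => l _.
  rewrite scalerA fc scaler_suml (F_linear_sum uF) scaler_sumr; over.
rewrite exchange_big; apply: eq_bigr => m _.
rewrite scalerA -rmorphM ec rmorph_sum scaler_suml; apply: eq_bigr => l _ /=.
rewrite -[c l m *: f m]mulr_algl -scalerA (F_linearZ uF) scalerA.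
congr (_ *: _).
by rewrite linearZ /= -[RHS]mulr_algl mulrC.
Qed.

Lemma twistD x y : twist s u (x + y) = twist s u x + twist s u y.
Proof.
rewrite -big_split; apply: eq_bigr => l _.
by rewrite scalerDr (F_linearD uF) scalerDr.
Qed.

Lemma twist_F_linear : F_linear (twist s u).
Proof. by move=> k x y; rewrite twistD twistZ linearZ /= rmorph1. Qed.

Lemma twist0 : twist s u 0 = 0.
Proof. exact: (F_linear0 twist_F_linear). Qed.

Lemma twist_id x : (forall a, u (a *: x) = s a *: u x) -> twist s u x = u x.
Proof.
move=> ux; rewrite /twist; under eq_bigr do rewrite ux scalerA -rmorphM.
by rewrite -scaler_suml -rmorph_sum ef1 rmorph1 scale1r.
Qed.

End TwistTheory.

(** Summing over [s] turns [s (e l)] into the trace of [e l], a scalar of [F] that passes through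
    [u]. *)
Lemma sum_twist (V W : lmodType E) (u : V -> W) x : F_linear u ->
    galois 1 {:E} ->
  \sum_(s in 'Gal({:E} / 1)%g) twist s u x = u x.
Proof.
move=> uF galE; rewrite exchange_big /= -[in RHS](scale1r x) -[in RHS]ef_trace.
rewrite scaler_suml (F_linear_sum uF); apply: eq_bigr => l _.
rewrite -scaler_suml -scalerA -/(galTrace 1 {:E} (e l)).
have /vlineP[k ->] := mem_galTrace galE (memvf (e l)).
by rewrite (F_linearZ uF).
Qed.

(* iota embeds V as an F-ideal of h, with an equivariant retraction kappa.    *)
Section Embedding.
Hypothesis galE : galois 1 {:E}.
Variables (V : finLieAlgType E) (h : lieAlgType E).
Variables (iota : V -> h) (kappa : h -> V).
Hypothesis iotaF : F_linear iota.
Hypothesis kappaF : F_linear kappa.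
Hypothesis iotaK : cancel iota kappa.
Hypothesis iota_br : forall z y, lie_br z (iota y) = iota (lie_br (kappa z) y).

(** Bracketing with [z] acts on the image of [iota] through bracketing with [kappa z] in [V], an
    E-linear map, hence compatible with twisting. *)
Lemma twist_brl s x z :
  lie_br (twist s iota x) z = twist s iota (lie_br x (kappa z)).
Proof.
rewrite lie_br_suml; apply: eq_bigr => l _.
by rewrite lie_brZl lie_brC iota_br -(F_linearN iotaF) -lie_brC lie_brZl.
Qed.

Lemma twist_br s x y :
  lie_br (twist s iota x) (iota y) = twist s iota (lie_br x y).
Proof. by rewrite twist_brl iotaK. Qed.

(** The s-component of [iota] seen inside [V]; by [uC] it lies in the centroid of [V] over [F]. *)
Let u s := kappa \o twist s iota.

Let uF s : F_linear (u s).
Proof. by apply: F_linear_comp => //; apply: twist_F_linear. Qed.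

Let uC s x y : u s (lie_br x y) = lie_br (u s x) y.
Proof. by rewrite /u /= -twist_br iota_br iotaK. Qed.

(** On a bracket the scalar moves to the factor that [uC] leaves untouched. *)
Let uZ s a x : x \in derived V -> u s (a *: x) = a *: u s x.
Proof.
move: x; apply: (@derived_ind _ _ (fun x => u s (a *: x) = a *: u s x)) =>
  [x y ux uy|x y].
  by rewrite scalerDr !(F_linearD (uF s)) ux uy scalerDr.
by rewrite -linearZ /= !uC linearZ.
Qed.

(** The image of [iota] is an ideal, so by [twist_br] it contains the twist of a bracket. *)
Let iota_u s x : x \in derived V -> iota (u s x) = twist s iota x.
Proof.
move: x; apply: (@derived_ind _ _ (fun x => iota (u s x) = twist s iota x)) =>
  [x y ux uy|x y].
  by rewrite (F_linearD (uF s)) (F_linearD iotaF) ux uy twistD.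
by rewrite uC -iota_br twist_br.
Qed.

(** By [uZ] the factors [f l] enter [u s], and by s-linearity they come out as [s (f l)]; what
    remains is the sum of the [s (e l * f l)], which is 1. *)
Let uu s x : x \in derived V -> u s (u s x) = u s x.
Proof.
move=> dx; rewrite {1}/u /= {1}/twist.
under eq_bigr => l _.
  rewrite -uZ // iota_u ?rpredZ // twistZ // scalerA -rmorphM; over.
by rewrite -scaler_suml -rmorph_sum ef1 rmorph1 scale1r.
Qed.

Let u_derived s x : x \in derived V -> u s x \in derived V.
Proof.
move: x; apply: (@derived_ind _ _ (fun x => u s x \in derived V)) =>
  [x y ux uy|x y].
  by rewrite (F_linearD (uF s)) rpredD.
by rewrite uC br_derived.
Qed.

(** [u s] is known to be E-linear on the derived algebra only; its component at the identity is
    E-linear on all of [V] and agrees with it there. *)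
Let q s := twist 1%g (u s).

Let q_linear s : linear (q s).
Proof. by move=> a x y; rewrite /q twistD // twistZ // gal_id. Qed.

Let qE s x : x \in derived V -> q s x = u s x.
Proof. by move=> dx; apply: twist_id => a; rewrite gal_id uZ. Qed.

Lemma semilinear_on_derived : indecomposable V ->
  exists2 s, s \in 'Gal({:E} / 1)%g &
    forall x, x \in derived V -> twist s iota x = iota x.
Proof.
move=> indecV; have [d0|] := eqVneq (derived V) 0%VS.
  exists 1%g => [|x]; first exact: group1.
  by rewrite d0 memv0 => /eqP->; rewrite twist0 // (F_linear0 iotaF).
rewrite -vpick0; set x0 := vpick _ => nz_x0.
have dx0 : x0 \in derived V by apply: memv_pick.
(* The components add up to [iota x0], which is nonzero; a component nonzero at [x0] excludes the
   zero alternative for [q s]. *)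
have [/existsP[s /andP[Gs sx0]]|] :=
  boolP [exists s in 'Gal({:E} / 1)%g, twist s iota x0 != 0]; last first.
  rewrite negb_exists_in => /forall_inP tw0.
  case/negP: nz_x0.
  rewrite -[x0]iotaK -(sum_twist _ iotaF galE) big1 => [|s Gs].
    by rewrite (F_linear0 kappaF).
  by apply/eqP; rewrite -[_ == _]negbK tw0.
exists s => // x dx.
pose qM := GRing.isLinear.Build _ _ _ _ (q s) (q_linear s).
pose qL : {linear V -> V} := HB.pack (q s) qM.
have [|x1 dx1|q0|q1] := @centroid_idempotent _ V indecV (linfun qL).
- move=> x1 y1; rewrite !lfunE /= /q /twist lie_br_suml; apply: eq_bigr => l _.
  by rewrite -lie_brZl uC lie_brZl.
- by rewrite !lfunE /= !qE ?uu ?u_derived // qE.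
- case/negP: sx0; rewrite -iota_u // -qE //.
  by have := q0 x0 dx0; rewrite lfunE /= => ->; rewrite (F_linear0 iotaF).
by rewrite -iota_u // -qE //; have := q1 x dx; rewrite lfunE /= => ->.
Qed.

End Embedding.
End Twist.

(** * Dimensions and completion of linear maps *)

(** Coordinate families over [E] are vector spaces over [F], of dimension [[E : F]] times the
    E-dimension; the comparison is made there. *)
Lemma F_linear_dim (F : fieldType) (E : splittingFieldType F)
    (V W : vectType E) (u : V -> W) :
  F_linear u -> injective u -> (\dim {:V} <= \dim {:W})%N.
Proof.
move=> uF u_inj.
pose A := {ffun 'I_(\dim {:V}) -> E}; pose B := {ffun 'I_(\dim {:W}) -> E}.
pose v (c : A) : V := \sum_i c i *: (vbasis {:V})`_i.
pose U (c : A) : B := [ffun j => coord (vbasis {:W}) j (u (v c))].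
have U_lin : linear U.
  move=> a c c'; apply/ffunP => j; rewrite !ffunE.
  have -> : v (a *: c + c') = a%:A *: v c + v c'.
    rewrite scaler_sumr -big_split; apply: eq_bigr => i _ /=.
    by rewrite !ffunE scalerA mulr_algl -scalerDl.
  by rewrite uF linearP /= mulr_algl.
pose UM := GRing.isLinear.Build _ _ _ _ U U_lin.
pose UL : {linear A -> B} := HB.pack U UM.
have U_inj : injective U.
  move=> c c' /ffunP eqU; have /u_inj vcc' : u (v c) = u (v c').
    rewrite [LHS](coord_vbasis (memvf _)) [RHS](coord_vbasis (memvf _)).
    by apply: eq_bigr => j _; have := eqU j; rewrite !ffunE => ->.
  apply/ffunP => i; have freeV := basis_free (vbasisP {:V}).
  rewrite -(coord_sum_free c i freeV) -(coord_sum_free c' i freeV).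
  by rewrite -!/(v _) vcc'.
have ker0 : lker (linfun UL) == 0%VS.
  by apply/lker0P => c c'; rewrite !lfunE; apply: U_inj.
have : (\dim (limg (linfun UL)) <= \dim {:B})%N by apply: dimvS; apply: subvf.
rewrite limg_dim_eq ?(eqP ker0) ?capv0 // !dimvf /dim /= !card_ord.
by rewrite -![dim E]dimvf leq_pmul2r // adim_gt0.
Qed.

(** Keep [P] on the image of the projector [M], and send its kernel isomorphically onto a complement
    of [P (M V)] chosen inside [Z]; the dimensions match. *)
Lemma linear_completion (K : fieldType) (V W : vectType K) (P : 'Hom(V, W))
    (M : 'End(V)) (Z : {vspace W}) :
    \dim {:V} = \dim {:W} -> (forall x, M (M x) = M x) ->
    (forall x, P (M x) = 0 -> M x = 0) -> (limg (P \o M) + Z)%VS = fullv ->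
  exists Q : 'Hom(V, W), [/\ lker Q == 0%VS,
    forall x, Q (M x) = P (M x) & forall x, Q x - P (M x) \in Z].
Proof.
move=> dimVW MM PM0 PMZ; pose U := lker M; pose Z' := (Z :\: limg (P \o M))%VS.
have dimZ' : \dim U = \dim Z'.
  have -> : U = lker (P \o M).
    apply/vspaceP => x; rewrite !memv_ker comp_lfunE.
    by apply/eqP/eqP => [->|/PM0]; rewrite ?linear0.
  apply/eqP; rewrite -(eqn_add2r (\dim (limg (P \o M)))).
  rewrite -[lker _]capfv limg_ker_dim dimVW -PMZ addvC -addv_diff.
  by rewrite dimv_disjoint_sum // capv_diff.
(* [r] carries a basis of [U] to one of [Z']; it is applied only to vectors [x - M x], which lie in
   [U]. *)
pose b x (j : 'I_(\dim Z')) := coord (vbasis U) (cast_ord (esym dimZ') j) x.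
pose r x := \sum_j b x j *: (vbasis Z')`_j.
have r_lin : linear r.
  move=> a x y; rewrite scaler_sumr -big_split; apply: eq_bigr => i _ /=.
  by rewrite /b linearP scalerDl scalerA.
pose rM := GRing.isLinear.Build _ _ _ _ r r_lin.
pose rL : {linear V -> W} := HB.pack r rM.
have rZ x : r x \in Z'.
  apply: memv_suml => i _; apply/rpredZ/vbasis_mem/mem_nth.
  by rewrite size_tuple.
have r_inj x : x \in U -> r x = 0 -> x = 0.
  move=> Ux rx0; rewrite (coord_vbasis Ux) big1 // => i _.
  have freeZ := basis_free (vbasisP Z').
  have <- : b x (cast_ord dimZ' i) = coord (vbasis U) i x.
    by congr (coord _ _ _); apply: val_inj.
  by rewrite -(coord_sum_free (b x) _ freeZ) -/(r x) rx0 linear0 scale0r.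
pose Q := (P \o M)%VF + (linfun rL \o (\1%VF - M)%R)%VF.
have QE x : Q x = P (M x) + r (x - M x).
  by rewrite /Q add_lfunE !comp_lfunE (lfunE rL) add_lfunE opp_lfunE id_lfunE.
have rU x : x - M x \in U by rewrite memv_ker linearB /= MM subrr.
exists Q; split=> [|x|x].
- rewrite -subv0; apply/subvP => x; rewrite memv_ker memv0 QE => /eqP PMr0.
  have : P (M x) \in (Z' :&: limg (P \o M))%VS.
    rewrite memv_cap -{2}comp_lfunE memv_img ?memvf // andbT.
    by rewrite -[P _](addrK (r (x - M x))) PMr0 sub0r rpredN rZ.
  rewrite capv_diff memv0 => /eqP PM_0; move: PMr0; rewrite PM_0 add0r.
  by rewrite (PM0 _ PM_0) subr0 => /r_inj-> //; rewrite -[x]subr0 -(PM0 _ PM_0).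
- by rewrite QE MM subrr [r 0](linear0 rL) addr0.
by rewrite QE addrC addKr (subvP (diffvSl _ _) _ (rZ _)).
Qed.

(** * Direct sums and their conjugates *)

Section DirectSumTheory.
Variables (K : fieldType) (I : finType) (L : I -> lieAlgType K).

Local Notation D := (lie_dsum L).

Definition dsum_coord i (x : D) : L i := dsum_proj x i.

Lemma dsum_projP i (a : K) (x y : D) :
  dsum_proj (a *: x + y) i = a *: dsum_proj x i + dsum_proj y i.
Proof. by rewrite !dsum_mkE. Qed.

HB.instance Definition _ i := GRing.isLinear.Build K D (L i) _
  (@dsum_coord i) (dsum_projP i).

Lemma dsum_proj_br i (x y : D) :
  dsum_proj (lie_br x y) i = lie_br (dsum_proj x i) (dsum_proj y i).
Proof. exact: dsum_mkE. Qed.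

Definition dsum_inj i (x : L i) : D := dsum_mk (dfwith (fun=> 0) x).

Lemma dsum_inj_in i (x : L i) : dsum_proj (dsum_inj x) i = x.
Proof. by rewrite dsum_mkE dfwith_in. Qed.

Lemma dsum_inj_out i (x : L i) j : i != j -> dsum_proj (dsum_inj x) j = 0.
Proof. by move=> ij; rewrite dsum_mkE dfwith_out. Qed.

Lemma dsum_injP i : linear (@dsum_inj i).
Proof.
move=> a x y; apply: dsumP => j; rewrite dsum_projP.
have [<-|ij] := eqVneq i j; first by rewrite !dsum_inj_in.
by rewrite !dsum_inj_out // scaler0 addr0.
Qed.

HB.instance Definition _ i := GRing.isLinear.Build K (L i) D _
  (@dsum_inj i) (@dsum_injP i).

Lemma br_dsum_inj i (x : D) (y : L i) :
  lie_br x (dsum_inj y) = dsum_inj (lie_br (dsum_proj x i) y).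
Proof.
apply: dsumP => j; rewrite dsum_proj_br.
have [<-|ij] := eqVneq i j; first by rewrite !dsum_inj_in.
by rewrite !dsum_inj_out // lie_br0r.
Qed.

Lemma dsum_decomp (x : D) : x = \sum_i dsum_inj (dsum_proj x i).
Proof.
apply: dsumP => j; rewrite -[RHS]/(dsum_coord j _) linear_sum (bigD1 j) //=.
rewrite /dsum_coord dsum_inj_in big1 ?addr0 // => i ij.
by rewrite dsum_inj_out.
Qed.

End DirectSumTheory.

(** * Gluing the semilinear components over all summands *)

Section Assembly.
Variables (F : fieldType) (E : splittingFieldType F).
Variables (n : nat) (e f : 'I_n -> E).
Hypothesis ef_balanced : forall a, exists c : 'I_n -> 'I_n -> F,
  (forall l, f l * a = \sum_m c l m *: f m) /\
  (forall m, a * e m = \sum_l c l m *: e l).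
Variables (h : finLieAlgType E) (k : nat) (gi : 'I_k -> finLieAlgType E).
Hypothesis indec_gi : forall i, indecomposable (gi i).

Local Notation D := (lie_dsum gi).

Variables (phi : D -> h) (psi : h -> D).
Hypotheses (phiF : F_linear phi) (psiF : F_linear psi).
Hypotheses (phiK : cancel phi psi) (psiK : cancel psi phi).
Hypothesis phi_br : {morph phi : x y / lie_br x y}.

Let iota i (x : gi i) : h := phi (dsum_inj x).
Let kappa i (z : h) : gi i := dsum_proj (psi z) i.

Let iotaF i : F_linear (@iota i).
Proof. exact: (F_linear_comp phiF (F_linear_linear (@dsum_inj _ _ gi i))). Qed.

Let iota_br i z (y : gi i) : lie_br z (iota y) = iota (lie_br (kappa i z) y).
Proof. by rewrite -{1}[z]psiK -phi_br br_dsum_inj. Qed.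

Variable s : 'I_k -> gal_of {:E}.
Hypothesis s_derived : forall i x, x \in derived (gi i) ->
  twist e f (s i) (@iota i) x = iota x.

Let G (d : forall i, gi i) : h := \sum_i twist e f (s i) (@iota i) (d i).

Let phiE (d : D) : phi d = \sum_i iota (dsum_proj d i).
Proof. by rewrite {1}[d]dsum_decomp (F_linear_sum phiF). Qed.

(** A bracket turns each component into its value on a derived element, where [s_derived] identifies
    it with [iota]. So [G] and [phi] differ by central values. *)
Let G_br (d : D) z : lie_br (G (dsum_proj d)) z = lie_br (phi d) z.
Proof.
rewrite phiE !lie_br_suml; apply: eq_bigr => i _.
rewrite (twist_brl e f (@iotaF i) (@iota_br i)) s_derived ?br_derived //.
by rewrite [RHS]lie_brC iota_br -(F_linearN (@iotaF i)) -lie_brC.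
Qed.

Let G_derived (d : D) : (forall i, dsum_proj d i \in derived (gi i)) ->
  G (dsum_proj d) = phi d.
Proof.
by move=> dd; rewrite phiE; apply: eq_bigr => i _; apply/s_derived/dd.
Qed.

Local Notation T := {i : 'I_k & 'I_(\dim {: gi i})}.
Local Notation V := {ffun T -> E^o}.
Local Notation bas i := (vbasis {: gi i}).
Local Notation D_s := (lie_dsum (fun i => lie_conjugate (s i) (gi i))).

Let galKV (t : gal_of {:E}) a : t ((t^-1)%g a) = a.
Proof. by rewrite -galM ?memvf // mulVg gal_id. Qed.

Let tg i (j : 'I_(\dim {: gi i})) : T := existT _ i j.

(** The inverse automorphism makes [V] a coordinate space over [E] for the sum of the conjugates,
    while [J] into [D] is only F-linear. *)
Let loc (c : V) i : gi i := \sum_j (s i)^-1%g (c (@tg i j)) *: (bas i)`_j.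

Let J (c : V) : D := dsum_mk (loc c).

Let JE c i : dsum_proj (J c) i = loc c i.
Proof. exact: dsum_mkE. Qed.

Let loc_lin i a c c' :
  loc (a *: c + c') i = (s i)^-1%g a *: loc c i + loc c' i.
Proof.
rewrite scaler_sumr -big_split; apply: eq_bigr => j _ /=.
by rewrite !ffunE rmorphD rmorphM scalerDl scalerA.
Qed.

Let JF : F_linear J.
Proof.
move=> a c c'; apply: dsumP => i; rewrite dsum_projP !JE loc_lin.
by rewrite linearZ /= rmorph1.
Qed.

Let J_inj : injective J.
Proof.
move=> c c' cc'; apply/ffunP => -[i j].
have freeb := basis_free (vbasisP {: gi i}).
apply: (can_inj (galKV (s i))); rewrite -!/(@tg i j).
rewrite -(coord_sum_free (fun j => (s i)^-1%g (c (@tg i j))) j freeb).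
rewrite -(coord_sum_free (fun j => (s i)^-1%g (c' (@tg i j))) j freeb).
by rewrite -!/(loc _ i) -!JE cc'.
Qed.

Let J' (d : D) : V :=
  [ffun t : T =>
     s (tag t) (coord (bas (tag t)) (tagged t) (dsum_proj d (tag t)))].

Let locJ' d i : loc (J' d) i = dsum_proj d i.
Proof.
rewrite [RHS](coord_vbasis (memvf _)).
by apply: eq_bigr => j _; rewrite ffunE Defs.galK.
Qed.

Let J'K d : J (J' d) = d.
Proof. by apply: dsumP => i; rewrite JE locJ'. Qed.

Let J'F : F_linear J'.
Proof. by move=> a x y; apply: J_inj; rewrite JF !J'K. Qed.

(** [phi] and [psi] are only F-linear, hence an injection in each direction. *)
Let dimVh : \dim {: V} = \dim {: h}.
Proof.
apply/eqP; rewrite eqn_leq.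
rewrite (F_linear_dim (F_linear_comp phiF JF)); last first.
  by apply: inj_comp J_inj; apply: can_inj phiK.
rewrite (F_linear_dim (F_linear_comp J'F psiF)) //.
by apply: inj_comp (can_inj J'K) (can_inj psiK).
Qed.

Let P0 (c : V) : h := G (dsum_proj (J c)).

(** The [s i]-linearity of the twisted embedding cancels the inverse automorphism in [loc]. *)
Let P0_lin : linear P0.
Proof.
move=> a c c'; rewrite scaler_sumr -big_split; apply: eq_bigr => i _ /=.
rewrite !JE loc_lin (twistD _ _ _ (@iotaF i)).
by rewrite (twistZ ef_balanced _ (@iotaF i)) galKV.
Qed.

HB.instance Definition _ := GRing.isLinear.Build E V h _ P0 P0_lin.

(** The projector onto the coordinates of the nonabelian summands. *)
Let M0 (c : V) : V :=
  [ffun t : T => if derived (gi (tag t)) == 0%VS then 0 else c t].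

Let M0_lin : linear M0.
Proof.
move=> a c c'; apply/ffunP => t; rewrite !ffunE.
by case: ifP; rewrite // scaler0 addr0.
Qed.

HB.instance Definition _ := GRing.isLinear.Build E V V _ M0 M0_lin.

Let locM c i : loc (M0 c) i = if derived (gi i) == 0%VS then 0 else loc c i.
Proof.
rewrite /loc; case: ifP => di; last by apply: eq_bigr => j _; rewrite ffunE di.
by rewrite big1 // => j _; rewrite ffunE di rmorph0 scale0r.
Qed.

Let br_loc_M c i y : lie_br (loc (M0 c) i) y = lie_br (loc c i) y.
Proof.
rewrite locM; case: eqP => // d0; rewrite lie_br0l.
by have := br_derived (loc c i) y; rewrite d0 memv0 => /eqP.
Qed.

Let phi_JM c z : lie_br (phi (J (M0 c))) z = lie_br (phi (J c)) z.
Proof.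
rewrite -[z]psiK -!phi_br; congr phi; apply: dsumP => i.
by rewrite !dsum_proj_br !JE br_loc_M.
Qed.

(** By [G_br] the components are central, hence derived in the nonabelian summands; there [G] is
    [phi], which is injective. *)
Let PM0 c : P0 (M0 c) = 0 -> M0 c = 0.
Proof.
move=> PM_0; have Z i : loc (M0 c) i \in center (gi i).
  apply/centerP => y.
  rewrite -JE -[y](@dsum_inj_in _ _ (fun i => gi i) i) -dsum_proj_br.
  rewrite -[lie_br _ _]phiK phi_br -G_br -/(P0 _) PM_0.
  rewrite lie_br0l (F_linear0 psiF).
  exact: (linear0 (@dsum_coord _ _ gi i)).
apply: J_inj; rewrite (F_linear0 JF); apply: (can_inj phiK).
rewrite (F_linear0 phiF) -PM_0; apply/esym/G_derived => i; rewrite JE.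
have := Z i; rewrite locM; case: eqP => [_ _|/eqP d0]; first exact: mem0v.
by apply/subvP/center_sub_derived; first exact: indec_gi.
Qed.

Let PMZ : (limg (linfun P0 \o linfun M0) + center h)%VS = fullv.
Proof.
apply/vspaceP => z; rewrite memvf.
rewrite -[z]psiK -[psi z]J'K; set c := J' _.
rewrite -[phi _](subrK (P0 (M0 c))) addrC memv_add //.
  have <- : (linfun P0 \o linfun M0)%VF c = P0 (M0 c).
    by rewrite comp_lfunE !lfunE.
  by rewrite memv_img ?memvf.
by apply/centerP => y; rewrite lie_brBl G_br phi_JM subrr.
Qed.

Lemma conjugate_sum_iso : lie_isomorphic h D_s.
Proof.
have MM c : linfun M0 (linfun M0 c) = linfun M0 c.
  by rewrite !lfunE; apply/ffunP => t; rewrite !ffunE; case: eqP.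
have PM c : linfun P0 (linfun M0 c) = 0 -> linfun M0 c = 0.
  by rewrite !lfunE; apply: PM0.
have [Q [Q0 QM QZ]] := linear_completion dimVh MM PM PMZ.
have QM0 c : Q (M0 c) = P0 (M0 c) by have := QM c; rewrite !lfunE.
have Q1 : limg Q = fullv.
  apply/eqP; rewrite eqEdim subvf limg_dim_eq ?(eqP Q0) ?capv0 //.
  exact: eq_leq (esym dimVh).
have QK : cancel Q (Q^-1)%VF := lker0_lfunK Q0.
have KQ : cancel (Q^-1)%VF Q by move=> x; rewrite limg_lfunVK // Q1 memvf.
(* [Q c] differs from [P0 (M0 c)] by a central element, and [M0] drops only central components. *)
have Qbr c z : lie_br (Q c) z = lie_br (phi (J c)) z.
  have /centerP/(_ z) := QZ c; rewrite !lfunE lie_brBl => /eqP.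
  by rewrite subr_eq0 => /eqP ->; rewrite G_br phi_JM.
(* A bracket has no component in an abelian summand, so [M0] fixes it and [Q] is [phi] there. *)
have Q_J' a b : Q (J' (lie_br (J a) (J b))) = lie_br (Q a) (Q b).
  rewrite Qbr [RHS]lie_brC Qbr -lie_brC -phi_br; set c := J' _.
  have Mc : M0 c = c.
    apply: J_inj; apply: dsumP => i; rewrite !JE locM; case: eqP => // d0.
    have := br_derived (dsum_proj (J a) i) (dsum_proj (J b) i).
    by rewrite d0 memv0 locJ' dsum_proj_br => /eqP.
  rewrite -Mc QM0 Mc -[in RHS](J'K (lie_br _ _)) -/c.
  by rewrite /P0 G_derived // => i; rewrite JE locJ' dsum_proj_br br_derived.
(* The same map as [J], now E-linear because its target carries the conjugate scalars. *)
pose Js (c : V) : D_s := dsum_mk (loc c).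
have JsE c i : dsum_proj (Js c) i = loc c i by apply: dsum_mkE.
have Js_lin : linear Js.
  by move=> a c c'; apply: dsumP => i; rewrite dsum_projP !JsE loc_lin.
pose JsM := GRing.isLinear.Build _ _ _ _ Js Js_lin.
pose JsL : {linear V -> D_s} := HB.pack Js JsM.
exists (JsL \o (Q^-1)%VF : {linear h -> D_s}); split.
  exists (fun d : D_s => Q (J' d)) => [x|d] /=; last first.
    by rewrite QK; apply: dsumP => i; exact: etrans (JsE _ i) (locJ' d i).
  rewrite -[RHS]KQ; congr (Q _); apply: J_inj; apply: dsumP => i.
  by rewrite !JE locJ'; apply: JsE.
move=> x y /=; rewrite -[in LHS](KQ x) -[in LHS](KQ y) -Q_J' QK.
by apply: dsumP => i; rewrite dsum_proj_br !JsE locJ' dsum_proj_br !JE.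
Qed.

End Assembly.

(** * Restriction of scalars and conclusion *)

Lemma F_linear_can (F : fieldType) (E : splittingFieldType F)
    (V W : lmodType E) (u : V -> W) (v : W -> V) :
  F_linear u -> cancel u v -> cancel v u -> F_linear v.
Proof. by move=> uF uK vK k x y; rewrite -{1}[x]vK -{1}[y]vK -uF uK. Qed.

Lemma underlying_F_linear (F : fieldType) (E : splittingFieldType F)
    (V W : lieAlgType E) (u : {linear underlying_lie V -> underlying_lie W}) :
  F_linear (u : V -> W).
Proof. by move=> k x y; apply: (linearP u). Qed.

Lemma can_morph_br (K K' : fieldType) (V : lieAlgType K) (W : lieAlgType K')
    (u : V -> W) (v : W -> V) :
  {morph u : x y / lie_br x y >-> lie_br x y} -> cancel u v -> cancel v u ->
  {morph v : x y / lie_br x y >-> lie_br x y}.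
Proof. by move=> ubr uK vK x y; rewrite -{1}[x]vK -{1}[y]vK -ubr uK. Qed.

Theorem theorem4p3 (F : fieldType) (E : splittingFieldType F)
    (galE : galois 1 {:E}) (g h : finLieAlgType E)
    (iso_gh : lie_isomorphic (underlying_lie g) (underlying_lie h))
    (k : nat) (gi : 'I_k -> finLieAlgType E)
    (iso_g : lie_isomorphic g (lie_dsum gi))
    (indec_gi : forall i : 'I_k, indecomposable (gi i)) :
  exists sigma : 'I_k -> gal_of {:E},
    (forall i : 'I_k, sigma i \in 'Gal({:E} / 1)%g) /\
    lie_isomorphic h (lie_dsum (fun i : 'I_k => lie_conjugate (sigma i) (gi i))).
Proof.
case: iso_gh => u [[u' uK u'K] u_br]; case: iso_g => v [[v' vK v'K] v_br].
have uF : F_linear (u : g -> h) := underlying_F_linear u.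
have u'F : F_linear (u' : h -> g) := F_linear_can uF uK u'K.
have vF := F_linear_linear v; have v'F := F_linear_can vF vK v'K.
have v'_br := can_morph_br v_br vK v'K.
pose phi (d : lie_dsum gi) : h := u (v' d).
pose psi (z : h) : lie_dsum gi := v (u' z).
have phiF : F_linear phi := F_linear_comp uF v'F.
have psiF : F_linear psi := F_linear_comp vF u'F.
have phiK : cancel phi psi by move=> d; rewrite /psi uK v'K.
have psiK : cancel psi phi by move=> z; rewrite /phi vK u'K.
have phi_br : {morph phi : x y / lie_br x y >-> lie_br x y}.
  by move=> x y; rewrite /phi v'_br; apply: u_br.
have [e [f [ef_balanced ef1 ef_trace]]] := trace_dual_bases galE.
have ex_s i : exists s, s \in 'Gal({:E} / 1)%g /\ forall x,
    x \in derived (gi i) ->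
  twist e f s (fun y => phi (dsum_inj y)) x = phi (@dsum_inj _ _ gi i x).
  have [||||s Gs sP] := semilinear_on_derived ef_balanced ef1 ef_trace galE
    (iota := fun y => phi (@dsum_inj _ _ gi i y))
    (kappa := fun z => dsum_proj (psi z) i) _ _ _ _ (@indec_gi i);
    last by exists s.
  - exact: (F_linear_comp phiF (F_linear_linear (@dsum_inj _ _ gi i))).
  - exact: (F_linear_comp (F_linear_linear (@dsum_coord _ _ gi i)) psiF).
  - by move=> x; rewrite phiK dsum_inj_in.
  - by move=> z y; rewrite -{1}[z]psiK -phi_br br_dsum_inj.
have [s sP] := fin_all_exists ex_s.
exists s; split=> [i|]; first by have [] := sP i.
apply: (conjugate_sum_iso ef_balanced indec_gi phiF psiF phiK psiK phi_br).
by move=> i; have [] := sP i.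
Qed.
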